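(* Let $G(t,u,v,z,x)=\sum_{w} t^{\mathrm{length}(w)}u^{\mathrm{asc}(w)}v^{\mathrm{last}(w)}z^{\mathrm{zeros}(w)}x^{\mathrm{run}(w)}$, where the sum is over all ascent sequences $w$ (including the empty one). For $s\ge 1$ put $\delta_s=u-(1-t)^s(u-1)$, $\gamma_s=u-(1-zt)(1-t)^{s-1}(u-1)$, $\bar\delta_s=uv-(1-t)^s(uv-1)$, $\bar\gamma_s=uv-(1-zt)(1-t)^{s-1}(uv-1)$, and $\delta_0=\gamma_0=\bar\delta_0=\bar\gamma_0=1$. Then, as formal power series, $$G(t,u,v,z,x)=\frac{1}{1-tz}+\frac{t^2zxu}{(1-tzx)(v\delta_1-1)}\Big(v(v-1)+t(1-u)(z(v-1)-v)\sum_{s\ge 0}\frac{u^s(1-t)^s}{\delta_s\delta_{s+1}\prod_{i=1}^{s+1}\gamma_i}+uv^3t(1-uv)\sum_{s\ge0}\frac{(uv)^s(1-t)^s}{\bar\delta_s\bar\delta_{s+1}\prod_{i=1}^{s+1}\bar\gamma_i}\Big).$$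
   Context: An ascent sequence of length $n$ is a sequence $(x_1,\dots,x_n)$ of nonnegative integers with $x_1=0$ and $x_i\in[0,1+\mathrm{asc}(x_1,\dots,x_{i-1})]$ for $2\le i\le n$, where $\mathrm{asc}(y_1,\dots,y_k)=|\{1\le j<k: y_j<y_{j+1}\}|$; the empty sequence is also an ascent sequence. For an ascent sequence $w$: $\mathrm{length}(w)$ is its number of entries, $\mathrm{asc}(w)$ its number of ascents, $\mathrm{last}(w)$ its rightmost entry (0 for the empty sequence), $\mathrm{zeros}(w)$ its number of entries equal to 0, and $\mathrm{run}(w)$ is the number of 0's to the left of the leftmost nonzero entry, with $\mathrm{run}(w)=0$ if $w$ has no nonzero entry. (This series is also the generating function of (2+2)-free posets by size, number of levels, level of the minimum maximal element, number of minimal elements, and size of the last nontrivial down-set.) All series are formal power series in $t,u,v,z,x$ over $\mathbb{Q}$; $v\delta_1-1$ has constant term $-1$ and each $\delta_s,\gamma_s,\bar\delta_s,\bar\gamma_s$ has constant term $1$, so all quotients are formal power series, and the $s$-th summands are divisible by $u^s$, so the sums converge formally. *)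

(* Defs.v *)
From HB Require Import structures.
From mathcomp Require Import all_boot all_order all_algebra.
Set Implicit Arguments. Unset Strict Implicit. Unset Printing Implicit Defensive.
Import Order.TTheory GRing.Theory Num.Theory.
Local Open Scope ring_scope.

Definition asc (y : seq nat) : nat :=
  count (fun p : nat * nat => (p.1 < p.2)%N) (zip y (behead y)).

Definition is_ascent (w : seq nat) : bool :=
  [forall i : 'I_(size w),
     (nth 0%N w i <= (if (i == 0 :> nat) then 0 else (asc (take i w)).+1))%N].

Definition lastw (w : seq nat) : nat := last 0%N w.
Definition zeros (w : seq nat) : nat := count_mem 0%N w.
Definition run (w : seq nat) : nat :=
  if has (fun a => a != 0%N) w then find (fun a => a != 0%N) w else 0%N.

(* ---------- Formal power series in t,u,v,z,x over rat ----------
   f a b c d e is the coefficient of t^a u^b v^c z^d x^e. *)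
Definition fps := nat -> nat -> nat -> nat -> nat -> rat.

Definition is0 (a b c d e : nat) : bool :=
  [&& a == 0%N, b == 0%N, c == 0%N, d == 0%N & e == 0%N].

Definition fmono (i j k l m : nat) : fps :=
  fun a b c d e => ([&& a == i, b == j, c == k, d == l & e == m])%:R.

Definition fC (r : rat) : fps := fun a b c d e => if is0 a b c d e then r else 0.
Definition fone : fps := fC 1.
Definition ft : fps := fmono 1 0 0 0 0.
Definition fu : fps := fmono 0 1 0 0 0.
Definition fv : fps := fmono 0 0 1 0 0.
Definition fz : fps := fmono 0 0 0 1 0.
Definition fx : fps := fmono 0 0 0 0 1.

Definition fadd (f g : fps) : fps := fun a b c d e => f a b c d e + g a b c d e.
Definition fopp (f : fps) : fps := fun a b c d e => - f a b c d e.
Definition fsub (f g : fps) : fps := fadd f (fopp g).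

Definition fmul (f g : fps) : fps := fun a b c d e =>
  \sum_(i < a.+1) \sum_(j < b.+1) \sum_(k < c.+1) \sum_(l < d.+1) \sum_(m < e.+1)
     f i j k l m * g (a - i)%N (b - j)%N (c - k)%N (d - l)%N (e - m)%N.

Definition fexp (f : fps) (n : nat) : fps := iter n (fmul f) fone.

(* Multiplicative inverse of a series with nonzero constant term, via the
   recurrence coming from f * g = 1 (k is fuel; it suffices that k is at least
   the total degree of the monomial). *)
Fixpoint finv_aux (f : fps) (n : nat) {struct n} : fps :=
  fun a b c d e =>
  if is0 a b c d e then (f 0 0 0 0 0)^-1
  else if n is n'.+1 then
    - (f 0 0 0 0 0)^-1 *
      \sum_(i < a.+1) \sum_(j < b.+1) \sum_(k < c.+1) \sum_(l < d.+1) \sum_(m < e.+1)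
        (if [&& (i == a :> nat), (j == b :> nat), (k == c :> nat),
                (l == d :> nat) & (m == e :> nat)] then 0
         else finv_aux f n' i j k l m *
              f (a - i)%N (b - j)%N (c - k)%N (d - l)%N (e - m)%N)
  else 0.

Definition finv (f : fps) : fps := fun a b c d e =>
  finv_aux f (a + b + c + d + e) a b c d e.

Definition fdiv (f g : fps) : fps := fmul f (finv g).

(* Sum over s >= 0 of a family F whose s-th member is divisible by u^s:
   the coefficient of t^a u^b v^c z^d x^e only receives contributions
   from s <= b, so the formal (u-adically convergent) sum is: *)
Definition fsumu (F : nat -> fps) : fps := fun a b c d e =>
  \sum_(s < b.+1) F s a b c d e.

Declare Scope fps_scope.
Delimit Scope fps_scope with P.
Notation "f + g" := (fadd f g) : fps_scope.
Notation "f - g" := (fsub f g) : fps_scope.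
Notation "f * g" := (fmul f g) : fps_scope.
Notation "f / g" := (fdiv f g) : fps_scope.
Notation "f ^+ n" := (fexp f n) : fps_scope.
Notation "1" := fone : fps_scope.

Definition fprod1 (n : nat) (F : nat -> fps) : fps :=
  \big[fmul/fone]_(1 <= i < n.+1) F i.

(* G: coefficient of t^a u^b v^c z^d x^e is the number of ascent sequences w of
   length a with asc(w)=b, last(w)=c, zeros(w)=d, run(w)=e.  Entries of an ascent
   sequence of length a are < a, so all of them occur among a-tuples over 'I_a. *)
Definition Gser : fps := fun a b c d e =>
  (#|[set w : a.-tuple 'I_a |
       let w' := map val (tval w) in
       [&& is_ascent w', asc w' == b, lastw w' == c, zeros w' == d & run w' == e]]|)%:R.

Definition delta (s : nat) : fps :=
  if s is 0 then fone else (fu - (1 - ft) ^+ s * (fu - 1))%P.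
Definition gamma (s : nat) : fps :=
  if s is 0 then fone else (fu - (1 - fz * ft) * (1 - ft) ^+ s.-1 * (fu - 1))%P.
Definition deltab (s : nat) : fps :=
  if s is 0 then fone else (fu * fv - (1 - ft) ^+ s * (fu * fv - 1))%P.
Definition gammab (s : nat) : fps :=
  if s is 0 then fone
  else (fu * fv - (1 - fz * ft) * (1 - ft) ^+ s.-1 * (fu * fv - 1))%P.

(* Main.v *)
(* Let H(U,V) be the series of the ascent sequences having a nonzero entry, U
   marking ascents and V the last entry. Appending one letter to such a
   sequence gives
     (V - 1 - tV + tUV) H(U,V) = (V - 1)(U V C' + t z H(U,1)) - t V H(U,1)
                                 + t U V^2 H(UV,1),
   where U V C' accounts for the sequences 0...01. The choice
   V = 1 / (1 - t + tU) kills the left-hand side and expresses H(U,1) through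
   H(U',1) with U' = UV. Iterating, the s-th argument is U / delta_s(U), and as
   U^N divides the N-th remainder, H(U,1) is the announced sum whenever u
   divides U. The cases U = u and U = uv give H(u,v). *)
Require Import Defs.
From mathcomp Require Import all_boot all_order all_algebra.
From HB Require Import structures.
From mathcomp Require Import boolp ring zify.
(* [finv] is otherwise the inverse of a finite map, from fingraph. *)
Import Defs.

Set Implicit Arguments.
Unset Strict Implicit.
Unset Printing Implicit Defensive.
Import GRing.Theory.
Local Open Scope ring_scope.

(** * Formal power series *)

(** Plain functions, so that five nested copies over [rat] are convertible to [fps]. *)
Definition ps (R : Type) := nat -> R.

Section PowerSeries.
Variable R : comNzRingType.
Implicit Types f g h : ps R.

HB.instance Definition _ := gen_eqMixin (ps R).
HB.instance Definition _ := gen_choiceMixin (ps R).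

Definition ps_zero : ps R := fun=> 0.
Definition ps_one : ps R := fun n => (n == 0%N)%:R.
Definition ps_opp f : ps R := fun n => - f n.
Definition ps_add f g : ps R := fun n => f n + g n.
Definition ps_mul f g : ps R := fun n => \sum_(i < n.+1) f i * g (n - i)%N.

Lemma ps_addA : associative ps_add.
Proof. by move=> f g h; apply/funext=> n; apply: addrA. Qed.

Lemma ps_addC : commutative ps_add.
Proof. by move=> f g; apply/funext=> n; apply: addrC. Qed.

Lemma ps_add0 : left_id ps_zero ps_add.
Proof. by move=> f; apply/funext=> n; apply: add0r. Qed.

Lemma ps_addN : left_inverse ps_zero ps_opp ps_add.
Proof. by move=> f; apply/funext=> n; apply: addNr. Qed.

HB.instance Definition _ :=
  GRing.isZmodule.Build (ps R) ps_addA ps_addC ps_add0 ps_addN.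

(* Identities between coefficients of index at most n hold because they hold
   between polynomials. *)
Lemma ps_mul_poly f g (p q : {poly R}) n :
    (forall i, (i <= n)%N -> p`_i = f i) ->
    (forall i, (i <= n)%N -> q`_i = g i) ->
  forall i, (i <= n)%N -> (p * q)`_i = ps_mul f g i.
Proof.
move=> pf qg i le_in; rewrite coefM; apply: eq_bigr => j _.
by rewrite pf ?qg //; apply: leq_trans le_in; rewrite ?leq_subr ?leq_ord.
Qed.

Lemma coef_trunc f n i : (i <= n)%N -> (\poly_(j < n.+1) f j)`_i = f i.
Proof. by move=> le_in; rewrite coef_poly ltnS le_in. Qed.

Lemma ps_mulC : commutative ps_mul.
Proof.
move=> f g; apply/funext=> n; have trunc h := @coef_trunc h n.
rewrite -(ps_mul_poly (trunc f) (trunc g)) // mulrC.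
exact: (ps_mul_poly (trunc g) (trunc f)).
Qed.

Lemma ps_mulA : associative ps_mul.
Proof.
move=> f g h; apply/funext=> n; have trunc k := @coef_trunc k n.
have fg := ps_mul_poly (trunc f) (trunc g).
have gh := ps_mul_poly (trunc g) (trunc h).
rewrite -(ps_mul_poly (trunc f) gh) // mulrA.
exact: (ps_mul_poly fg (trunc h)).
Qed.

Lemma ps_mul1 : left_id ps_one ps_mul.
Proof.
move=> f; apply/funext=> n; rewrite /ps_mul big_ord_recl /= mul1r subn0.
by rewrite big1 ?addr0 // => i _; rewrite mul0r.
Qed.

Lemma ps_mulDl : left_distributive ps_mul ps_add.
Proof.
move=> f g h; apply/funext=> n; rewrite /ps_mul /ps_add -big_split /=.
by apply: eq_bigr => i _; rewrite mulrDl.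
Qed.

Lemma ps_oner_neq0 : ps_one != 0.
Proof. by apply/eqP => /(congr1 (@^~ 0%N)) /eqP; rewrite oner_eq0. Qed.

HB.instance Definition _ := GRing.Zmodule_isComNzRing.Build (ps R)
  ps_mulA ps_mulC ps_mul1 ps_mulDl ps_oner_neq0.

Lemma ps_mulE f g n : (f * g) n = \sum_(i < n.+1) f i * g (n - i)%N.
Proof. by []. Qed.

End PowerSeries.

Lemma ps_sumE (R : comNzRingType) (I : Type) (r : seq I) (P : pred I)
  (F : I -> ps R) n : (\sum_(i <- r | P i) F i) n = \sum_(i <- r | P i) F i n.
Proof. by elim/big_rec2: _ => // i y1 y2 _ <-. Qed.

(** * Series in five variables as a commutative ring *)

Definition ps5 := ps (ps (ps (ps (ps rat)))).

(** The five-fold convolution is the one-variable convolution nested five times, so the ring laws of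
    [fmul] come from those of [ps]. *)
Lemma fmulE (f g : fps) : fmul f g = (f : ps5) * (g : ps5).
Proof.
apply/funext=> a; apply/funext=> b; apply/funext=> c; apply/funext=> d.
apply/funext=> e; rewrite /fmul.
rewrite ps_mulE !ps_sumE; apply: eq_bigr => i _.
rewrite ps_mulE !ps_sumE; apply: eq_bigr => j _.
rewrite ps_mulE !ps_sumE; apply: eq_bigr => k _.
rewrite ps_mulE !ps_sumE; apply: eq_bigr => l _.
by rewrite ps_mulE.
Qed.

Lemma foneE : fone = (1 : ps5).
Proof.
apply/funext=> a; apply/funext=> b; apply/funext=> c; apply/funext=> d.
apply/funext=> e; rewrite /fone /fC /is0.
case: a => [|a] //; case: b => [|b] //; case: c => [|c] //.
by case: d => [|d] //; case: e.
Qed.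

(* Not a copy of the instance of [ps5]: conversion would then compare unfolded
   nested structures, in exponential time. *)
HB.instance Definition _ := gen_eqMixin fps.
HB.instance Definition _ := gen_choiceMixin fps.

Definition fzero : fps := fun _ _ _ _ _ => 0.

Lemma faddA : associative fadd.
Proof. by move=> f g h; do 5![apply/funext=> ?]; apply: addrA. Qed.

Lemma faddC : commutative fadd.
Proof. by move=> f g; do 5![apply/funext=> ?]; apply: addrC. Qed.

Lemma fadd0 : left_id fzero fadd.
Proof. by move=> f; do 5![apply/funext=> ?]; apply: add0r. Qed.

Lemma faddN : left_inverse fzero fopp fadd.
Proof. by move=> f; do 5![apply/funext=> ?]; apply: addNr. Qed.

HB.instance Definition _ := GRing.isZmodule.Build fps faddA faddC fadd0 faddN.

Lemma fmulA : associative fmul.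
Proof. by move=> f g h; rewrite !fmulE; apply: (@mulrA ps5). Qed.

Lemma fmulC : commutative fmul.
Proof. by move=> f g; rewrite !fmulE; apply: (@mulrC ps5). Qed.

Lemma fmul1 : left_id fone fmul.
Proof. by move=> f; rewrite fmulE foneE; apply: (@mul1r ps5). Qed.

Lemma fmulDl : left_distributive fmul fadd.
Proof. by move=> f g h; rewrite !fmulE; apply: (@mulrDl ps5). Qed.

Lemma fone_neq0 : fone != fzero.
Proof. by apply/eqP => /(congr1 (fun f : fps => f 0 0 0 0 0)%N) /eqP. Qed.

HB.instance Definition _ := GRing.Zmodule_isComNzRing.Build fps
  fmulA fmulC fmul1 fmulDl fone_neq0.

Lemma fmulR (f g : fps) : fmul f g = f * g. Proof. by []. Qed.

Lemma foneR : fone = 1 :> fps. Proof. by []. Qed.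

Lemma fexpR (f : fps) n : fexp f n = f ^+ n.
Proof.
elim: n => [|n IHn]; first exact: foneR.
by rewrite exprS -IHn -fmulR.
Qed.

Lemma fps_eq (f g : fps) :
  (forall a b c d e, f a b c d e = g a b c d e) -> f = g.
Proof.
by move=> fg; do 4![apply/funext=> ?]; apply/funext=> e; apply: fg.
Qed.

Lemma fps_addE (f g : fps) a b c d e :
  (f + g) a b c d e = f a b c d e + g a b c d e.
Proof. by []. Qed.

Lemma fps_oppE (f : fps) a b c d e : (- f) a b c d e = - f a b c d e.
Proof. by []. Qed.

Lemma fps_mulE (f g : fps) a b c d e : (f * g) a b c d e =
  \sum_(i < a.+1) \sum_(j < b.+1) \sum_(k < c.+1) \sum_(l < d.+1)
    \sum_(m < e.+1)
    f i j k l m * g (a - i)%N (b - j)%N (c - k)%N (d - l)%N (e - m)%N.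
Proof. by rewrite -fmulR. Qed.

Lemma fps_sumE (I : Type) (r : seq I) (P : pred I) (F : I -> fps) a b c d e :
  (\sum_(i <- r | P i) F i) a b c d e = \sum_(i <- r | P i) F i a b c d e.
Proof. by elim/big_rec2: _ => // i y1 y2 _ <-. Qed.

(** The factor on the right covers an index out of range; the five sums in a product with a monomial
    are then collapsed one by one. *)
Lemma sum_pick n i (F : nat -> rat) :
  \sum_(j < n.+1) (j == i :> nat)%:R * F j = (i <= n)%:R * F i.
Proof.
have [le_in|lt_ni] := leqP i n; last first.
  rewrite big1 ?mul0r // => j _; case: eqVneq => [ji|]; last by rewrite mul0r.
  by have := ltn_ord j; rewrite ji ltnS leqNgt lt_ni.
rewrite (bigD1 (Ordinal (le_in : (i < n.+1)%N))) //= eqxx big1 ?addr0 // => j.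
by rewrite -val_eqE /= => /negPf->; rewrite mul0r.
Qed.

Lemma fmono_mulE i j k l m (g : fps) a b c d e :
  (fmono i j k l m * g) a b c d e =
  [&& i <= a, j <= b, k <= c, l <= d & m <= e]%N%:R *
    g (a - i)%N (b - j)%N (c - k)%N (d - l)%N (e - m)%N.
Proof.
rewrite fps_mulE -!mulnb !natrM -!mulrA.
rewrite -(sum_pick a i (fun i' => (j <= b)%N%:R * ((k <= c)%N%:R * ((l <= d)%N%:R *
  ((m <= e)%N%:R * g (a - i')%N (b - j)%N (c - k)%N (d - l)%N (e - m)%N))))).
apply: eq_bigr => i' _.
rewrite -(sum_pick b j (fun j' => (k <= c)%N%:R * ((l <= d)%N%:R *
  ((m <= e)%N%:R * g (a - i')%N (b - j')%N (c - k)%N (d - l)%N (e - m)%N)))).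
rewrite mulr_sumr; apply: eq_bigr => j' _.
rewrite -(sum_pick c k (fun k' => (l <= d)%N%:R *
  ((m <= e)%N%:R * g (a - i')%N (b - j')%N (c - k')%N (d - l)%N (e - m)%N))).
rewrite !mulr_sumr; apply: eq_bigr => k' _.
rewrite -(sum_pick d l (fun l' =>
  (m <= e)%N%:R * g (a - i')%N (b - j')%N (c - k')%N (d - l')%N (e - m)%N)).
rewrite !mulr_sumr; apply: eq_bigr => l' _.
rewrite -(sum_pick e m (fun m' => g (a - i')%N (b - j')%N (c - k')%N (d - l')%N (e - m')%N)).
rewrite !mulr_sumr; apply: eq_bigr => m' _.
by rewrite /fmono -!mulnb !natrM !mulrA.
Qed.

Lemma fmonoM i j k l m i' j' k' l' m' :
  fmono i j k l m * fmono i' j' k' l' m' =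
  fmono (i + i') (j + j') (k + k') (l + l') (m + m').
Proof.
apply: fps_eq => a b c d e; rewrite fmono_mulE /fmono -natrM mulnb.
by congr (_%:R); lia.
Qed.

Lemma fmono0 : fmono 0 0 0 0 0 = 1.
Proof.
rewrite -[RHS]foneR; apply: fps_eq => a b c d e; rewrite /fmono /fone /fC /is0.
by case: ifP.
Qed.

Lemma fmonoX i j k l m n :
  fmono i j k l m ^+ n = fmono (n * i) (n * j) (n * k) (n * l) (n * m).
Proof.
elim: n => [|n IHn]; first by rewrite expr0 !mul0n fmono0.
by rewrite exprS IHn fmonoM -!mulSn.
Qed.

Lemma t_mulE (g : fps) a b c d e :
  (ft * g) a b c d e = if a is a'.+1 then g a' b c d e else 0.
Proof.
rewrite fmono_mulE !leq0n !andbT !subn0.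
by case: a => [|a]; rewrite ?mul0r // subn1 mul1r.
Qed.

Lemma t_mulI (f g : fps) : ft * f = ft * g -> f = g.
Proof.
move=> eq_tfg; apply: fps_eq => a b c d e.
by have := t_mulE f a.+1 b c d e; rewrite eq_tfg t_mulE.
Qed.

(** * Divisibility by powers of t and u, and infinite sums *)

Definition vanish_t N (f : fps) :=
  forall a b c d e, (a < N)%N -> f a b c d e = 0.

Definition vanish_u N (f : fps) :=
  forall a b c d e, (b < N)%N -> f a b c d e = 0.

Lemma vanish_tXM N f : vanish_t N (ft ^+ N * f).
Proof.
move=> a b c d e lt_aN.
by rewrite fmonoX fmono_mulE muln1 leqNgt lt_aN mul0r.
Qed.

Lemma vanish_uM M N f g :
  vanish_u M f -> vanish_u N g -> vanish_u (M + N) (f * g).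
Proof.
move=> f0 g0 a b c d e lt_b; rewrite fps_mulE.
rewrite big1 // => i _; rewrite big1 // => j _; rewrite big1 // => k _.
rewrite big1 // => l _; rewrite big1 // => m _.
have [lt_jM|le_Mj] := ltnP j M; first by rewrite f0 ?mul0r.
by rewrite g0 ?mulr0 //; have := ltn_ord j; lia.
Qed.

Lemma vanish_uMr N f g : vanish_u N f -> vanish_u N (f * g).
Proof. by move=> f0; rewrite -[N]addn0; apply: vanish_uM. Qed.

Lemma vanish_uX f n : vanish_u 1 f -> vanish_u n (f ^+ n).
Proof.
by move=> f0; elim: n => // n IHn; rewrite exprS -add1n; apply: vanish_uM.
Qed.

Lemma vanish_u_fu : vanish_u 1 fu.
Proof. by move=> a [] // c d e _; rewrite /fu /fmono andbF. Qed.

(** At u^b with b < N, the series [fsumu F] keeps the terms s <= b, and the further ones with s < N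
    vanish there. *)
Lemma fsumu_tail (F : nat -> fps) N : (forall s, vanish_u s (F s)) ->
  vanish_u N (\sum_(s < N) F s - fsumu F).
Proof.
move=> F0 a b c d e lt_bN; rewrite fps_addE fps_oppE /fsumu.
apply/eqP; rewrite subr_eq0 eq_sym fps_sumE; apply/eqP.
rewrite -(big_mkord xpredT (fun s => F s a b c d e)).
rewrite -[RHS](big_mkord xpredT (fun s => F s a b c d e)).
rewrite [RHS](big_cat_nat (n := b.+1)) //= [X in _ + X]big_nat_cond.
by rewrite [X in _ + X]big1 ?addr0 // => s /andP[/andP[lt_bs _] _]; apply: F0.
Qed.

(* [tsum f] is the sum over [n] of [ft ^+ n * f n]. *)
Definition tsum (f : nat -> fps) : fps :=
  fun a b c d e => \sum_(n < a.+1) f n (a - n)%N b c d e.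

Lemma tsum_recl f : tsum f = f 0%N + ft * tsum (fun n => f n.+1).
Proof.
apply: fps_eq => a b c d e.
rewrite /tsum big_ord_recl subn0 fps_addE t_mulE.
congr (_ + _); case: a => [|a]; first by rewrite big_ord0.
by apply: eq_bigr => i _; rewrite subSS.
Qed.

Lemma tsum_split f N :
  tsum f = \sum_(n < N) ft ^+ n * f n + ft ^+ N * tsum (fun n => f (N + n)%N).
Proof.
elim: N => [|N ->]; first by rewrite big_ord0 expr0 mul1r add0r.
rewrite big_ord_recr tsum_recl addn0 mulrDr mulrA -exprSr addrA /=.
by congr (_ + _ * tsum _); apply/funext=> n; rewrite addSnnS.
Qed.

Lemma tsumD f g : tsum (fun n => f n + g n) = tsum f + tsum g.
Proof. by apply: fps_eq => a b c d e; rewrite [LHS]big_split. Qed.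

(** Up to a multiple of t^N both sides are finite sums, where distributivity applies; N = a + 1
    settles the coefficients of t^a. *)
Lemma tsumZ h f : tsum (fun n => h * f n) = h * tsum f.
Proof.
apply: fps_eq => a b c d e; apply/eqP; rewrite -subr_eq0.
rewrite -fps_oppE -fps_addE; apply/eqP.
rewrite (tsum_split _ a.+1) (tsum_split f a.+1) mulrDr mulr_sumr.
rewrite (eq_bigr (fun n : 'I_a.+1 => h * (ft ^+ n * f n))); last first.
  by move=> n _; rewrite mulrCA.
rewrite opprD addrACA subrr add0r mulrCA -mulrBr.
exact: vanish_tXM.
Qed.

(** * Constant terms and inverses *)

Definition cst (f : fps) : rat := f 0 0 0 0 0.

Lemma cstM f g : cst (f * g) = cst f * cst g.
Proof. by rewrite /cst fps_mulE !big_ord_recl !big_ord0 !addr0. Qed.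

Lemma cst1 : cst 1 = 1. Proof. by []. Qed.

Lemma cstD f g : cst (f + g) = cst f + cst g. Proof. by []. Qed.

Lemma cstN f : cst (- f) = - cst f. Proof. by []. Qed.

Lemma cstX f n : cst (f ^+ n) = cst f ^+ n.
Proof.
elim: n => [|n IHn]; first by rewrite !expr0.
by rewrite !exprS cstM IHn.
Qed.

Definition cstE := (cstM, cstD, cstN, cst1, cstX).

(** The recursive calls leave out the top index, so the total degree drops strictly and any fuel
    that bounds it gives the same value. *)
Lemma finv_aux_fuel f n1 n2 a b c d e :
  (a + b + c + d + e <= n1)%N -> (a + b + c + d + e <= n2)%N ->
  finv_aux f n1 a b c d e = finv_aux f n2 a b c d e.
Proof.
elim: n1 n2 a b c d e => [|n1 IHn] [|n2] a b c d e //=.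
- by move=> h _; rewrite (_ : is0 _ _ _ _ _) // /is0; lia.
- by move=> _ h; rewrite (_ : is0 _ _ _ _ _) // /is0; lia.
move=> h1 h2; case: ifP => // _; congr (_ * _).
apply: eq_bigr => i _; apply: eq_bigr => j _; apply: eq_bigr => k _.
apply: eq_bigr => l _; apply: eq_bigr => m _; case: ifP => // ne.
have := ltn_ord i; have := ltn_ord j; have := ltn_ord k.
have := ltn_ord l; have := ltn_ord m => *.
by congr (_ * _); apply: IHn; lia.
Qed.

Lemma finv_rec f a b c d e : ~~ is0 a b c d e ->
  finv f a b c d e = - (cst f)^-1 *
    \sum_(i < a.+1) \sum_(j < b.+1) \sum_(k < c.+1) \sum_(l < d.+1)
      \sum_(m < e.+1)
      (if [&& i == a :> nat, j == b :> nat, k == c :> nat, l == d :> nat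
            & m == e :> nat] then 0
       else finv f i j k l m *
            f (a - i)%N (b - j)%N (c - k)%N (d - l)%N (e - m)%N).
Proof.
move=> n0; rewrite {1}/finv; case En: (a + b + c + d + e)%N => [|n].
  by case/negP: n0; rewrite /is0; lia.
rewrite /= (negPf n0); congr (_ * _).
apply: eq_bigr => i _; apply: eq_bigr => j _; apply: eq_bigr => k _.
apply: eq_bigr => l _; apply: eq_bigr => m _; case: ifP => // ne.
congr (_ * _); apply: finv_aux_fuel => //.
have := ltn_ord i; have := ltn_ord j; have := ltn_ord k.
by have := ltn_ord l; have := ltn_ord m; lia.
Qed.

Lemma finvP f : cst f != 0 -> f * finv f = 1.
Proof.
move=> f0; apply: fps_eq => a b c d e.
rewrite -[RHS]/((1 : fps) a b c d e) -foneR /fone /fC.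
have [/and5P[]|n0] := ifP.
  do 5![move/eqP->]; rewrite -[LHS]/(cst (f * finv f)) cstM.
  exact: divff.
set x := finv f a b c d e.
pose top (i j k l m : nat) := [&& i == a, j == b, k == c, l == d & m == e].
(* [g] is [finv f] without its coefficient [x] at (a, b, c, d, e), and [h] is the monomial carrying
   [x]. By the recurrence, [g * f] has there the coefficient - [cst f * x], which that of [h * f]
   cancels. *)
pose g : fps := fun i j k l m => if top i j k l m then 0 else finv f i j k l m.
pose h : fps := fun i j k l m => x * fmono a b c d e i j k l m.
have -> : finv f = g + h.
  apply: fps_eq => i j k l m.
  rewrite fps_addE /g /h /fmono /top.
  case: ifP => [/and5P[]|_]; last by rewrite mulr0 addr0.
  by do 5![move/eqP->]; rewrite mulr1 add0r.
have gf : (g * f) a b c d e = - cst f * x.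
  rewrite /x finv_rec ?n0 // mulrA mulrNN divff // mul1r fps_mulE.
  do 5![apply: eq_bigr => ? _]; rewrite /g /top.
  by case: ifP; rewrite ?mul0r.
have hf : (h * f) a b c d e = x * (fmono a b c d e * f) a b c d e.
  rewrite !fps_mulE.
  by do 5![rewrite mulr_sumr; apply: eq_bigr => ? _]; rewrite /h mulrA.
rewrite mulrC mulrDl fps_addE gf hf fmono_mulE !leqnn mul1r !subnn -/(cst f).
by rewrite mulNr mulrC addNr.
Qed.

(** * Ascent sequences *)

Notation nonzero := (has (fun a : nat => a != 0%N)).

Lemma asc_rcons w y :
  asc (rcons w y) = (asc w + ((w != [::]) && (last 0%N w < y)%N))%N.
Proof.
case: w => [|x w] //=; elim: w x => [|x' w IHw] x; first by rewrite /asc /= addn0.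
have asc_cons s : asc (x :: x' :: s) = ((x < x') + asc (x' :: s))%N by [].
by rewrite rcons_cons !asc_cons IHw addnA.
Qed.

Lemma is_ascentP w :
  reflect (forall i, (i < size w)%N ->
             (nth 0 w i <= if i == 0 then 0 else (asc (take i w)).+1)%N)
          (is_ascent w).
Proof.
apply: (iffP forallP) => [asc_w i lt_iw | asc_w i]; last exact: asc_w.
exact: (asc_w (Ordinal lt_iw)).
Qed.

(** The bound on a letter involves only the letters before it, so ascent sequences grow by appending
    letters. *)
Lemma is_ascent_rcons w y :
  is_ascent (rcons w y) =
  is_ascent w && (y <= if w == [::] then 0 else (asc w).+1)%N.
Proof.
apply/is_ascentP/andP => [asc_wy | [/is_ascentP asc_w le_y] i].
  split.
    apply/is_ascentP => i lt_iw.
    have := asc_wy i; rewrite size_rcons nth_rcons lt_iw -cats1 takel_cat; last exact: ltnW.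
    by apply; apply: ltnW.
  have := asc_wy (size w); rewrite size_rcons nth_rcons ltnn eqxx -cats1.
  by rewrite take_size_cat // size_eq0; apply.
rewrite size_rcons ltnS nth_rcons leq_eqVlt => /predU1P[->|lt_iw].
  by rewrite ltnn eqxx -cats1 take_size_cat // size_eq0.
by rewrite lt_iw -cats1 takel_cat ?asc_w // ltnW.
Qed.

(** A letter that makes no ascent is at most its predecessor, and one that does is at most the new
    number of ascents. This allows the range of an appended letter to be cut at the last letter. *)
Lemma is_ascent_last w : is_ascent w -> (last 0 w <= asc w)%N.
Proof.
elim/last_ind: w => // w y IHw; rewrite is_ascent_rcons asc_rcons last_rcons.
case/andP=> /IHw le_w; case: eqP => _; first by rewrite leqn0 => /eqP->.
by case: ltnP => /=; lia.
Qed.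

(** The bound on ascents feeds the induction; the bound on letters places the sequences of length n
    among the tuples over ['I_n] counted by [Gser]. *)
Lemma is_ascent_lt w : is_ascent w ->
  (asc w <= (size w).-1)%N && all (gtn (size w)) w.
Proof.
elim/last_ind: w => // w y IHw; rewrite is_ascent_rcons asc_rcons size_rcons.
case/andP=> /IHw {IHw} /andP[le_w lt_w]; rewrite all_rcons andbA => le_y.
apply/andP; split; last by apply: sub_all lt_w => i; apply: leqW.
case: w {lt_w} le_w le_y => [|x w] /= le_w; first by rewrite leqn0 => /eqP->.
by move=> le_y; apply/andP; split; [case: (_ < _)%N => /=|]; lia.
Qed.

(** * Listing of ascent sequences by length, the all-zero one apart *)

Lemma asc_nseq0 n : asc (nseq n 0%N) = 0%N.
Proof.
elim: n => [|n IHn] //; rewrite -addn1 nseqD cats1 asc_rcons IHn add0n.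
by rewrite ltn0 andbF.
Qed.

Lemma is_ascent_nseq0 n : is_ascent (nseq n 0%N).
Proof. by apply/is_ascentP => i _; rewrite nth_nseq if_same. Qed.

Lemma nonzeroPn w : ~~ nonzero w -> w = nseq (size w) 0%N.
Proof.
rewrite -all_predC => w0; apply/all_pred1P; apply: sub_all w0 => x /=.
by rewrite negbK.
Qed.

Lemma nonzero_nseq0 n : nonzero (nseq n 0%N) = false.
Proof. by rewrite has_nseq andbF. Qed.

Fixpoint nzseqs n : seq (seq nat) :=
  if n is m.+1 then
    (if m is 0 then [::] else [:: rcons (nseq m 0%N) 1%N]) ++
    [seq rcons w y | w <- nzseqs m, y <- iota 0 (asc w).+2]
  else [::].

Lemma mem_rcons_allpairs (s : seq (seq nat)) (t : seq nat -> seq nat) w y :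
  (rcons w y \in [seq rcons w y | w <- s, y <- t w]) = (w \in s) && (y \in t w).
Proof.
apply/allpairsPdep/andP => [[w' [y' [? ? /rcons_inj[-> ->]]]] // | [ws yt]].
by exists w, y.
Qed.

Lemma mem_nzseqs n w :
  (w \in nzseqs n) = [&& size w == n, is_ascent w & nonzero w].
Proof.
elim: n w => [|n IHn] w; first by case: w => [|x w]; rewrite ?andbF.
case/lastP: w => [|w y].
  rewrite mem_cat; apply/negP => /orP[|/allpairsPdep[w [y [_ _ eq0]]]].
    by case: n {IHn}.
  by case: w eq0.
rewrite mem_cat mem_rcons_allpairs IHn mem_iota add0n /= ltnS.
rewrite size_rcons eqSS is_ascent_rcons has_rcons.
(* Either the prefix [w] already has a nonzero letter, or it is all zeros; it then has no ascent,
   which forces [y] = 1. *)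
have [nz_w|/nonzeroPn w0] := boolP (nonzero w).
  rewrite orbT !andbT (_ : _ \in _ = false) /=; last first.
    case: n {IHn} => // n; rewrite inE; apply/negP => /eqP /rcons_inj[w0 _].
    by move: nz_w; rewrite w0 /= nonzero_nseq0.
  by case: w nz_w => // x w _; rewrite -!andbA.
rewrite !andbF orbF w0 size_nseq is_ascent_nseq0 asc_nseq0 /=.
case: n {IHn} => [|n]; first by case: (size w) y => [|?] [|?].
rewrite inE -[X in _ == X]/(rcons (nseq n.+1 0%N) 1%N) eqseq_rcons.
have [->|ne_n] := eqVneq (size w) n.+1; first by rewrite eqxx; case: y => [|[|y]].
rewrite [in LHS](_ : _ == _ = false) //; apply: contraNF ne_n => /eqP eq_n.
by rewrite -(size_nseq (size w) 0%N) eq_n size_nseq.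
Qed.

Lemma uniq_nzseqs n : uniq (nzseqs n).
Proof.
elim: n => // n IHn; rewrite cat_uniq; apply/and3P; split.
- by case: n {IHn}.
- apply/hasPn => _ /allpairsPdep[w [y [w_nz _ ->]]].
  move: w_nz; rewrite mem_nzseqs => /and3P[_ _ nz_w].
  case: n {IHn} => // n; rewrite inE.
  apply: contraTN nz_w => /eqP /rcons_inj[-> _].
  by rewrite /= nonzero_nseq0.
apply: allpairs_uniq_dep => // [w _|]; first exact: iota_uniq.
by move=> [w y] [w' y'] _ _ /= /rcons_inj[-> ->].
Qed.

Definition ascseqs n := nseq n 0%N :: nzseqs n.

Lemma mem_ascseqs n w : (w \in ascseqs n) = (size w == n) && is_ascent w.
Proof.
rewrite inE mem_nzseqs; have [nz_w|/nonzeroPn->] := boolP (nonzero w).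
  rewrite andbT orb_idl // => /eqP w0; move: nz_w.
  by rewrite w0 nonzero_nseq0.
rewrite !andbF orbF size_nseq is_ascent_nseq0 andbT.
apply/eqP/eqP => [/(congr1 size)|->] //; by rewrite !size_nseq.
Qed.

Lemma uniq_ascseqs n : uniq (ascseqs n).
Proof. by rewrite /= mem_nzseqs nonzero_nseq0 !andbF uniq_nzseqs. Qed.

Lemma perm_ascseqs n : perm_eq (ascseqs n)
  [seq map val (tval w) | w <- enum [set w : n.-tuple 'I_n | is_ascent (map val w)]].
Proof.
apply: uniq_perm; first exact: uniq_ascseqs.
  rewrite map_inj_uniq ?enum_uniq // => w1 w2 /(inj_map val_inj).
  exact: val_inj.
move=> w; rewrite mem_ascseqs; apply/andP/mapP => [[/eqP sz_w asc_w] | [s]].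
  have /andP[_] := is_ascent_lt asc_w; rewrite sz_w => lt_w.
  (* [pmap insub] drops no letter, since all are less than n. *)
  have val_w : map val (pmap (insub : nat -> option 'I_n) w) = w.
    rewrite (pmap_filter (insubK _)); apply/all_filterP.
    by apply: sub_all lt_w => i /= lt_i; rewrite insubT.
  have sz : size (pmap (insub : nat -> option 'I_n) w) == n.
    by rewrite -(size_map val) val_w sz_w.
  by exists (Tuple sz); rewrite ?mem_enum ?inE /= val_w.
by rewrite mem_enum inE => asc_s ->; rewrite size_map size_tuple eqxx.
Qed.

Lemma GserE a b c d e : Gser a b c d e =
  \sum_(w <- ascseqs a) [&& asc w == b, lastw w == c, zeros w == d & run w == e]%:R.
Proof.
rewrite (perm_big _ (perm_ascseqs a)) big_map big_enum_cond /=.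
rewrite /Gser cardE -sum1_size natr_sum big_enum /=.
rewrite big_mkcond [RHS]big_mkcond; apply: eq_bigr => w _.
rewrite !inE; case: (is_ascent _) => //=; by case: ifP.
Qed.

(** * The functional equation *)

Lemma zeros_rcons w y : zeros (rcons w y) = (zeros w + (y == 0%N))%N.
Proof. by rewrite /zeros -cats1 count_cat /= addn0. Qed.

Lemma run_rcons w y : nonzero w -> run (rcons w y) = run w.
Proof.
by move=> nz_w; rewrite /run -cats1 has_cat nz_w /= find_cat nz_w.
Qed.

Lemma sum_geom (R : comNzRingType) (v : R) m n : (m <= n)%N ->
  (v - 1) * (\sum_(m <= i < n) v ^+ i) = v ^+ n - v ^+ m.
Proof.
move=> le_mn; rewrite mulr_sumr -telescope_sumr //; apply: eq_bigr => i _.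
by rewrite exprS mulrBl mul1r.
Qed.

Lemma last_nseq0 n : last 0%N (nseq n 0%N) = 0%N.
Proof. by elim: n. Qed.

Section Weights.
Variables (R : comNzRingType) (z x : R).
Implicit Types (U V : R) (w : seq nat).

(** The length, marked by t, is left to the summation index. [U] and [V] are arguments because the
    iteration changes them, while [z] and [x] stay fixed. *)
Definition weight U V w : R :=
  U ^+ asc w * V ^+ last 0%N w * (z ^+ zeros w * x ^+ run w).

(** The letter 0 stands apart as it adds a zero. The letters from 1 to the last one make no ascent,
    the larger ones make one; both ranges are geometric sums in V, cleared by V - 1. The upper end
    of the second turns U^asc into (UV)^asc, whence the weight at UV. *)
Lemma sum_weight_rcons U V n w : w \in nzseqs n ->
  (V - 1) * (\sum_(y <- iota 0 (asc w).+2) weight U V (rcons w y)) =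
  (V - 1) * z * weight U 1 w + V * (weight U V w - weight U 1 w)
    + U * V * (V * weight (U * V) 1 w - weight U V w).
Proof.
rewrite mem_nzseqs => /and3P[_ /is_ascent_last le_w nz_w].
have w0 : w != [::] by case: (w) nz_w.
rewrite -[iota _ _]/(index_iota 0 (asc w).+2) big_ltn //.
rewrite (big_cat_nat (n := (last 0 w).+1)) ?ltnS ?(leqW le_w) //=.
have weightE y : weight U V (rcons w y) =
    U ^+ (asc w + (last 0 w < y)%N) * V ^+ y
      * (z ^+ (zeros w + (y == 0))%N * x ^+ run w).
  by rewrite /weight asc_rcons last_rcons zeros_rcons run_rcons // w0.
rewrite (eq_big_nat _ _ (F2 := fun y => U ^+ asc w * (z ^+ zeros w * x ^+ run w) * V ^+ y));
  last by move=> [|y] // /andP[_ le_y]; rewrite weightE ltnNge -ltnS le_y /= !addn0; ring.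
rewrite (eq_big_nat _ _ (m := (last 0 w).+1)
  (F2 := fun y => U ^+ (asc w).+1 * (z ^+ zeros w * x ^+ run w) * V ^+ y));
  last by move=> [|y] // /andP[lt_y _]; rewrite weightE lt_y /= addn0 addn1; ring.
rewrite -!mulr_sumr mulrDr [(V - 1) * (_ + _ * _)]mulrDr.
rewrite [(V - 1) * (_ * bigop _ _ _)]mulrCA [X in _ + (_ + X)]mulrCA.
rewrite !sum_geom ?ltnS ?(leqW le_w) //.
rewrite weightE ltn0 /weight !expr1n addn0 addn1 !exprS exprMn expr0.
ring.
Qed.

Definition Wsum U V n : R := \sum_(w <- nzseqs n) weight U V w.

Lemma weight_first_nonzero U V n :
  weight U V (rcons (nseq n.+1 0%N) 1%N) = U * V * (z * x) ^+ n.+1.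
Proof.
rewrite /weight asc_rcons asc_nseq0 last_rcons zeros_rcons /zeros count_nseq.
rewrite /run -cats1 has_cat orbT find_cat nonzero_nseq0 size_nseq /= last_nseq0.
by rewrite !addn0 mul1n !expr1 exprMn.
Qed.

(** The first term is the sequence 0...01, whose prefix is not in the list. Differences are written
    with [(-1) *] to suit the linearity of [T] assumed below. *)
Lemma Wsum_rec U V n : (V - 1) * Wsum U V n.+1 =
  (V - 1) * (U * V * (if n is 0 then 0 else (z * x) ^+ n))
  + ((V - 1) * z * Wsum U 1 n + (V * (Wsum U V n + (-1) * Wsum U 1 n)
     + U * V * (V * Wsum (U * V) 1 n + (-1) * Wsum U V n))).
Proof.
rewrite {1}/Wsum big_cat mulrDr; congr (_ * _ + _).
  case: n => [|n]; first by rewrite big_nil mulr0.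
  by rewrite big_seq1 weight_first_nonzero.
rewrite big_allpairs_dep mulr_sumr.
under eq_big_seq => w w_nz do rewrite (sum_weight_rcons _ _ w_nz).
by rewrite !big_split /= -!mulr_sumr !sumrB -!mulr_sumr !mulN1r !addrA.
Qed.

(* [T f] stands for the sum over [n] of [t ^+ n * f n]. Working in an abstract
   ring keeps [ring] from unfolding the operations of [fps]. *)
Variables (t : R) (T : (nat -> R) -> R).
Hypothesis T_recl : forall f, T f = f 0%N + t * T (fun n => f n.+1).
Hypothesis TD : forall f g, T (fun n => f n + g n) = T f + T g.
Hypothesis TZ : forall a f, T (fun n => a * f n) = a * T f.
Hypothesis t_mulI : forall a b, t * a = t * b -> a = b.

Definition Hser U V := T (Wsum U V).

(** This is tzx / (1 - tzx), for the zeros of 0...01; the final 1 brings the remaining factor t U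
    V. *)
Definition Cser := T (fun n => if n is 0 then 0 else (z * x) ^+ n).

(** Used for q = zx in [Cser], and finally for q = z, which gives the all-zero sequences. *)
Lemma T_geom q : (1 - t * q) * T (fun n => q ^+ n) = 1.
Proof.
rewrite mulrBl mul1r {1}T_recl expr0 -mulrA -(TZ q).
by under eq_fun do rewrite exprS; rewrite addrK.
Qed.

Lemma CserP : (1 - t * z * x) * Cser = t * z * x.
Proof.
rewrite /Cser T_recl add0r; under eq_fun do rewrite exprS.
by rewrite TZ -mulrA mulrCA [_ * (_ * T _)]mulrCA T_geom mulr1.
Qed.

Lemma Hser_eqn U V : (V - 1) * Hser U V =
  t * ((V - 1) * (U * V * Cser + z * Hser U 1) + V * (Hser U V - Hser U 1)
        + U * V * (V * Hser (U * V) 1 - Hser U V)).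
Proof.
rewrite {1}/Hser T_recl {1}/Wsum big_nil add0r mulrCA -[_ * T _]TZ; congr (_ * _).
under eq_fun do rewrite Wsum_rec.
rewrite !(TD, TZ) -!/(Hser _ _) -/Cser; ring.
Qed.

(* The substitution [V = 1 / (1 - t + t U)] cancels the terms in [Hser U V]. *)
Lemma kernel_eqn U V D : D = 1 - t + t * U -> V * D = 1 ->
  D * (1 - t * z * (1 - U)) * Hser U 1
  = t * Cser * U * (1 - U) + U * Hser (U * V) 1.
Proof.
move=> defD VD1; have := Hser_eqn U V.
set A := Hser U 1; set A' := Hser (U * V) 1; set h := Hser U V => eqn.
have eq0 : (V - 1) * (U * V * Cser + z * A) - V * A + U * V * V * A' = 0.
  apply: t_mulI; rewrite mulr0 -[RHS](subrr ((V - 1) * h)) {1}eqn.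
  have -> : (V - 1) * h = (t * V - t * U * V) * h.
    by rewrite -{1}VD1 defD; ring.
  ring.
(* The factor D^2 eliminates V by means of V D = 1. *)
have := congr1 (fun y => D * D * y) eq0; rewrite mulr0 => {}eq0.
apply/eqP; rewrite -subr_eq0 -oppr_eq0 -eq0; apply/eqP.
have -> : D * D * ((V - 1) * (U * V * Cser + z * A) - V * A + U * V * V * A')
  = (V * D - D) * (U * (V * D) * Cser + z * D * A) - (V * D) * D * A
     + U * (V * D) * (V * D) * A' by ring.
rewrite VD1 defD; ring.
Qed.

(** [K] is the kernel V - 1 - tV + tUV, written through delta_1. The functional equation is solved
    for [Hser U V], with [B] clearing the denominator of [Cser] and [S], [S'] standing for the sums
    at U and UV. *)
Lemma Hser_eval U V B K i S S' : B = 1 - t * z * x ->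
    K = V * (U - (1 - t) * (U - 1)) - 1 -> B * K * i = 1 ->
    Hser U 1 = t * Cser * U * (1 - U) * S ->
    Hser (U * V) 1 = t * Cser * (U * V) * (1 - U * V) * S' ->
  Hser U V = t ^+ 2 * z * x * U * i *
    (V * (V - 1) + t * (1 - U) * (z * (V - 1) - V) * S
      + U * V ^+ 3 * t * (1 - U * V) * S').
Proof.
move=> defB defK BKi eqA eqA'; have BC : B * Cser = t * z * x by rewrite defB CserP.
have KH : K * Hser U V = t * Cser * U *
    (V * (V - 1) + t * (1 - U) * (z * (V - 1) - V) * S
      + U * V ^+ 3 * t * (1 - U * V) * S').
  have := Hser_eqn U V; rewrite eqA eqA'.
  move: (Hser U V) => h eqn.
  have -> : K * h = (V - 1) * h - t * (V * h - U * V * h).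
    by rewrite defK; ring.
  by rewrite eqn; ring.
transitivity (i * (B * (K * Hser U V))); first by rewrite -[LHS]mul1r -BKi; ring.
rewrite KH -!mulrA [B * _]mulrCA [B * _]mulrA BC; ring.
Qed.

(** * Iteration of the kernel equation *)

Section Iteration.
Variables (U : R) (inv : R -> R).

Definition delta_at s := U - (1 - t) ^+ s * (U - 1).
(* The index is shifted: this is gamma_(s+1) of the statement. *)
Definition gamma_at s := U - (1 - z * t) * (1 - t) ^+ s * (U - 1).

Hypothesis dltP : forall s, delta_at s * inv (delta_at s) = 1.
Hypothesis gmP : forall s, gamma_at s * inv (gamma_at s) = 1.

(** This is the kernel equation at U / delta_s, cleared of denominators. Dividing [Hser] by delta_s
    makes the recursion uniform: each step multiplies by U / [gamma_at s]. *)
Lemma Hser_step s : Hser (U * inv (delta_at s)) 1 * inv (delta_at s) =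
  t * Cser * U * (1 - U) *
    ((1 - t) ^+ s * (inv (delta_at s) * inv (delta_at s.+1) * inv (gamma_at s)))
  + U * inv (gamma_at s) * (Hser (U * inv (delta_at s.+1)) 1 * inv (delta_at s.+1)).
Proof.
have := dltP s; have := dltP s.+1; have := gmP s.
have dltS : delta_at s.+1 = (1 - t) * delta_at s + t * U by rewrite /delta_at exprS; ring.
(* Hence 1 - tz(1 - U / delta_s) = [gamma_at s] / delta_s, a factor in the kernel equation. *)
have gmE : gamma_at s = delta_at s - t * z * (delta_at s - U) by rewrite /gamma_at /delta_at; ring.
have subU : delta_at s - U = (1 - t) ^+ s * (1 - U) by rewrite /delta_at; ring.
set d := delta_at s in dltS gmE subU *; set i := inv d.
set d' := delta_at s.+1 in dltS *; set i' := inv d'.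
set g := gamma_at s in gmE *; set j := inv g => gj d'i' di.
(* The choice V = delta_s / delta_(s+1) cancels the kernel by [dltS], and the next argument (U /
   delta_s) V is U / delta_(s+1). *)
have VD : d * i' * (1 - t + t * (U * i)) = 1.
  transitivity (i' * ((1 - t) * d + t * U * (d * i))); first by ring.
  by rewrite di mulr1 -dltS mulrC.
have := kernel_eqn erefl VD.
have -> : U * i * (d * i') = U * i'.
  by transitivity (U * i' * (d * i)); [ring | rewrite di mulr1].
set A := Hser _ 1; set A' := Hser _ 1 => eqA.
have eqn : d' * g * A = t * Cser * U * ((1 - t) ^+ s * (1 - U)) + U * d * A'.
  have := congr1 (fun y => d * d * y) eqA.
  have -> : d * d * ((1 - t + t * (U * i)) * (1 - t * z * (1 - U * i)) * A) =
    ((1 - t) * d + t * U * (d * i)) * (d - t * z * (d - U * (d * i))) * A by ring.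
  rewrite di !mulr1 -dltS -gmE => ->.
  have -> : d * d * (t * Cser * (U * i) * (1 - U * i) + U * i * A') =
    t * Cser * U * (d * i) * (d - U * (d * i)) + U * (d * i) * d * A' by ring.
  by rewrite di !mulr1 subU.
transitivity (i * i' * j * (d' * g * A)).
  transitivity (A * i * ((d' * i') * (g * j))); first by rewrite d'i' gj !mulr1.
  by ring.
rewrite eqn; transitivity (t * Cser * U * (1 - U) *
    ((1 - t) ^+ s * (i * i' * j)) + U * j * (A' * i') * (d * i)); first by ring.
by rewrite di mulr1.
Qed.

Lemma Hser_iter N : Hser U 1 = t * Cser * U * (1 - U) *
    (\sum_(s < N) U ^+ s * (1 - t) ^+ s *
      (inv (delta_at s) * inv (delta_at s.+1) * \prod_(i < s.+1) inv (gamma_at i)))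
  + U ^+ N * (\prod_(i < N) inv (gamma_at i) * (Hser (U * inv (delta_at N)) 1 * inv (delta_at N))).
Proof.
elim: N => [|N IHN].
  (* [inv] is arbitrary, so its value at delta_0 = 1 has to come from [dltP]. *)
  have inv1 : inv (delta_at 0) = 1.
    by rewrite -[LHS]mul1r -[X in X * _](_ : delta_at 0 = 1) ?dltP // /delta_at; ring.
  by rewrite !big_ord0 inv1 mulr0 add0r !mul1r !mulr1.
rewrite [LHS]IHN Hser_step !big_ord_recr /= exprSr; ring.
Qed.

End Iteration.
End Weights.

(** * Specialization to formal power series *)

Lemma fzX_fmono n : fz ^+ n = fmono 0 0 0 n 0.
Proof. by rewrite fmonoX !muln0 muln1. Qed.

Lemma weight_fmono w :
  weight fz fx fu fv w = fmono 0 (asc w) (lastw w) (zeros w) (run w).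
Proof. by rewrite /weight !fmonoX !fmonoM !muln0 !muln1 !addn0. Qed.

(** The monomials are free of t, so only n = a reaches the coefficient of t^a. *)
Lemma GserE_tsum a b c d e : Gser a b c d e =
  tsum (fun n => \sum_(w <- ascseqs n)
    fmono 0 (asc w) (lastw w) (zeros w) (run w)) a b c d e.
Proof.
rewrite GserE /tsum; under [RHS]eq_bigr => n _ do rewrite fps_sumE.
rewrite big_ord_recr [X in _ = X + _]big1 ?add0r /=; last first.
  move=> n _; rewrite big1 // => w _.
  by rewrite /fmono subn_eq0 leqNgt ltn_ord.
apply: eq_bigr => w _; rewrite /fmono subnn /=.
by rewrite ![_ == asc w]eq_sym ![_ == lastw w]eq_sym
    ![_ == zeros w]eq_sym ![_ == run w]eq_sym.
Qed.

(** The all-zero sequence has run 0 by convention, hence the term z^n without x. *)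
Lemma sum_ascseqs_fmono n :
  \sum_(w <- ascseqs n) fmono 0 (asc w) (lastw w) (zeros w) (run w)
  = fz ^+ n + Wsum fz fx fu fv n.
Proof.
rewrite big_cons; congr (_ + _); last first.
  by apply: eq_bigr => w _; rewrite weight_fmono.
rewrite asc_nseq0 /lastw last_nseq0 /zeros count_nseq mul1n /run.
by rewrite nonzero_nseq0 fzX_fmono.
Qed.

Lemma Gser_split : Gser = tsum (fun n => fz ^+ n) + Hser fz fx tsum fu fv.
Proof.
rewrite /Hser -tsumD; apply: fps_eq => a b c d e; rewrite GserE_tsum.
by under eq_fun do rewrite sum_ascseqs_fmono.
Qed.

(** * Inverses of products and the closed form of H(U, 1) *)

Lemma mul_inv_uniq (R : comNzRingType) (a b c : R) :
  a * b = 1 -> a * c = 1 -> b = c.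
Proof. by move=> ab ac; rewrite -[b]mulr1 -ac mulrCA mulrA ab mul1r. Qed.

Lemma finvM f g : cst f != 0 -> cst g != 0 -> finv (f * g) = finv f * finv g.
Proof.
move=> f0 g0; apply: (@mul_inv_uniq _ (f * g)).
  by rewrite finvP // cstM mulf_neq0.
by rewrite mulrACA !finvP ?mulr1.
Qed.

Lemma cst_prod n (F : nat -> fps) : (forall i, cst (F i) = 1) ->
  cst (\prod_(i < n) F i) = 1.
Proof.
move=> F1; elim: n => [|n IHn]; first by rewrite big_ord0.
by rewrite big_ord_recr cstM IHn F1 mulr1.
Qed.

Lemma finv_prod n (F : nat -> fps) : (forall i, cst (F i) = 1) ->
  finv (\prod_(i < n) F i) = \prod_(i < n) finv (F i).
Proof.
move=> F1; elim: n => [|n IHn].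
  rewrite !big_ord0; apply: (@mul_inv_uniq _ 1); last by rewrite mulr1.
  by rewrite finvP.
by rewrite !big_ord_recr finvM ?IHn ?F1 ?cst_prod.
Qed.

Lemma cst_delta_at U s : cst U = 0 -> cst (delta_at ft U s) = 1.
Proof. by move=> U0; rewrite !cstE U0 subr0 expr1n; ring. Qed.

Lemma cst_gamma_at U s : cst U = 0 -> cst (gamma_at fz ft U s) = 1.
Proof. by move=> U0; rewrite !cstE U0 mulr0 subr0 expr1n; ring. Qed.

Lemma vanish_uD N f g : vanish_u N f -> vanish_u N g -> vanish_u N (f + g).
Proof.
move=> f0 g0 a b c d e lt_bN.
by rewrite fps_addE f0 ?g0 ?addr0.
Qed.

Lemma vanish_u_eq f g : (forall N, vanish_u N (f - g)) -> f = g.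
Proof.
move=> fg0; apply: fps_eq => a b c d e; apply/eqP; rewrite -subr_eq0.
by rewrite -fps_oppE -fps_addE (fg0 b.+1).
Qed.

Definition summand U s := U ^+ s * (1 - ft) ^+ s *
  finv (delta_at ft U s * delta_at ft U s.+1 * \prod_(i < s.+1) gamma_at fz ft U i).

(** After N steps of the iteration, the two sides differ by a multiple of U^N and by a tail of
    [fsumu], both of which vanish below u^N. *)
Lemma Hser_closed U : vanish_u 1 U ->
  Hser fz fx tsum U 1 = ft * Cser fz fx tsum * U * (1 - U) * fsumu (summand U).
Proof.
move=> vU; have U0 : cst U = 0 by apply: vU.
have dlt1 s := cst_delta_at s U0; have gm1 s := cst_gamma_at s U0.
have summand0 s : vanish_u s (summand U s).
  by rewrite /summand -mulrA; apply/vanish_uMr/vanish_uX.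
apply: vanish_u_eq => N.
rewrite (@Hser_iter _ fz fx ft tsum tsum_recl tsumD tsumZ t_mulI U finv _ _ N);
  try by move=> s; rewrite finvP ?dlt1 ?gm1.
(* The product of inverses from the iteration becomes the inverse of one product, as in [summand];
   all constant terms involved are 1. *)
under eq_bigr => s _ do rewrite -finvM ?dlt1 // -finv_prod // -finvM ?cstM
  ?dlt1 ?mulr1 ?cst_prod // -/(summand U s).
rewrite addrAC -mulrBr; apply: vanish_uD; last exact/vanish_uMr/vanish_uX.
by rewrite mulrC; apply/vanish_uMr/fsumu_tail.
Qed.

(** * Translation to the notation of the statement *)

Lemma fprod1E n (F : nat -> fps) : fprod1 n F = \prod_(i < n) F i.+1.
Proof.
rewrite /fprod1 -[fmul]/(@GRing.mul fps) -[fone]/(1 : fps).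
by rewrite big_add1 big_mkord.
Qed.

Lemma deltaE s : delta s = delta_at ft fu s.
Proof.
case: s => [|s]; last by rewrite /delta fexpR.
by rewrite /delta_at expr0 mul1r opprB addrC subrK.
Qed.

Lemma deltabE s : deltab s = delta_at ft (fu * fv) s.
Proof.
case: s => [|s]; last by rewrite /deltab fexpR.
by rewrite /delta_at expr0 mul1r opprB addrC subrK.
Qed.

Lemma gammaE s : gamma s.+1 = gamma_at fz ft fu s.
Proof. by rewrite /gamma fexpR. Qed.

Lemma gammabE s : gammab s.+1 = gamma_at fz ft (fu * fv) s.
Proof. by rewrite /gammab fexpR. Qed.

Lemma summandE : summand fu = fun s =>
  ((fu ^+ s * (1 - ft) ^+ s) / (delta s * delta s.+1 * fprod1 s.+1 gamma))%P.
Proof.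
apply/funext=> s; rewrite /fdiv !fmulR !fexpR !deltaE fprod1E.
by under eq_bigr do rewrite gammaE.
Qed.

Lemma summandbE : summand (fu * fv) = fun s =>
  (((fu * fv) ^+ s * (1 - ft) ^+ s) /
     (deltab s * deltab s.+1 * fprod1 s.+1 gammab))%P.
Proof.
apply/funext=> s; rewrite /fdiv !fmulR !fexpR !deltabE fprod1E.
by under eq_bigr do rewrite gammabE.
Qed.

Theorem theorem4 :
  forall a b c d e : nat,
  Gser a b c d e =
  ((1 / (1 - ft * fz)) +
   (ft ^+ 2 * fz * fx * fu) / ((1 - ft * fz * fx) * (fv * delta 1 - 1)) *
   (fv * (fv - 1)
    + ft * (1 - fu) * (fz * (fv - 1) - fv) *
        fsumu (fun s => (fu ^+ s * (1 - ft) ^+ s) /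
                        (delta s * delta s.+1 * fprod1 s.+1 gamma))
    + fu * fv ^+ 3 * ft * (1 - fu * fv) *
        fsumu (fun s => ((fu * fv) ^+ s * (1 - ft) ^+ s) /
                        (deltab s * deltab s.+1 * fprod1 s.+1 gammab))))%P
    a b c d e.
Proof.
move=> a b c d e; rewrite -summandE -summandbE Gser_split.
rewrite deltaE /fdiv !fexpR.
congr (fadd _ _ a b c d e).
  apply: (@mul_inv_uniq _ (1 - ft * fz)).
    exact: (T_geom tsum_recl tsumZ).
  by rewrite -[fmul]/(@GRing.mul fps) mul1r finvP // !cstE.
(* At U = u and V = v, the factors [B] and [K] are 1 - tzx and v delta_1 - 1, with constant terms 1
   and -1. *)
apply: (Hser_eval tsum_recl tsumD tsumZ erefl erefl).
- by rewrite finvP // !cstE.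
- exact/Hser_closed/vanish_u_fu.
- exact/Hser_closed/vanish_uMr/vanish_u_fu.
Qed.
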